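(* Let $\Gamma$ and $\Lambda$ be finitely generated groups, let $\varphi\colon(0,\infty)\to(0,\infty)$ be a non-decreasing function, and assume that there exists a $(\varphi,\mathrm L^0)$-integrable measure equivalence coupling from $\Gamma$ to $\Lambda$. Then: \begin{itemize} \item if $\varphi(t)=t^p$ for some $p\geq 1$, then $j_{p,\Gamma}\succcurlyeq j_{p,\Lambda}$; \item if $\varphi$ and $t\mapsto t/\varphi(t)$ are increasing, then $j_{1,\Gamma}\succcurlyeq \varphi\circ j_{1,\Lambda}$. \end{itemize}
   Context: Fix finite symmetric generating sets $S_\Gamma$, $S_\Lambda$; $|\cdot|_{S}$ denotes word length. Isoperimetric profile. For a finitely generated group $G$ with finite symmetric generating set $S_G$, $p\ge 1$ and $f\colon G\to\mathbb R$ finitely supported, put $\|\nabla^l_{S_G} f\|_p^p=\sum_{g\in G,\,s\in S_G}|f(sg)-f(g)|^p$, and for $n\geq 1$ $$j_{p,G}(n)=\sup\left\{\frac{\|f\|_p}{\|\nabla^l_{S_G} f\|_p}\colon f\neq 0,\ |\operatorname{supp} f|\le n\right\}$$ (the ratio is $+\infty$ if the gradient vanishes, which can only happen if $G$ is finite; $\varphi(+\infty)$ means $\sup\varphi$). Asymptotic comparison. For monotone functions, $f\preccurlyeq g$ (equivalently $g\succcurlyeq f$) means that there is a constant $C>0$ with $f(n)=O(g(Cn))$ as $n\to\infty$. Measure equivalence couplings. A measure equivalence coupling from $\Gamma$ to $\Lambda$ is a quadruple $(\Omega,X_\Gamma,X_\Lambda,\mu)$, where $(\Omega,\mu)$ is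 a standard Borel space with a nonzero $\sigma$-finite measure, equipped with commuting, free (up to null sets), measure-preserving actions of $\Gamma$ and $\Lambda$, denoted $*$, and $X_\Gamma$, $X_\Lambda$ are Borel fundamental domains of finite measure for the $\Gamma$-action and the $\Lambda$-action respectively (a fundamental domain is a Borel set meeting almost every orbit in exactly one point). The group $\Gamma$ acts on $X_\Lambda$ by $\{\gamma\cdot x\}=(\Lambda*\gamma*x)\cap X_\Lambda$, and the cocycle $\alpha\colon\Gamma\times X_\Lambda\to\Lambda$ is defined by $\alpha(\gamma,x)*\gamma*x=\gamma\cdot x$. The coupling is $(\varphi,\mathrm L^0)$-integrable if for every $\gamma\in\Gamma$ there is $c_\gamma>0$ with $$\int_{X_\Lambda}\varphi\left(\frac{|\alpha(\gamma,x)|_{S_\Lambda}}{c_\gamma}\right)d\mu(x)<\infty$$ (no condition is imposed in the other direction). Since $\varphi$ is only defined on $(0,\infty)$, $\varphi(0)$ may be given any value in $[0,\inf\varphi]$; this is irrelevant as $\mu(X_\Lambda)<\infty$. *)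

(* Defs.v *)
From HB Require Import structures.
From mathcomp Require Import all_boot all_order all_algebra finmap.
From mathcomp Require Import all_classical all_reals all_analysis.

Set Implicit Arguments.
Unset Strict Implicit.
Unset Printing Implicit Defensive.

Import Order.TTheory GRing.Theory Num.Theory.
Import numFieldNormedType.Exports.

Local Open Scope classical_set_scope.
Local Open Scope ring_scope.

Section Groups.
Context {G : groupType}.

Definition words (S : {fset G}) (g : G) : set (seq G) :=
  [set w | {subset w <= S} /\ (\prod_(s <- w) s)%g = g].

(* By symmetry, words in [S] account for inverses as well. *)
Definition symmetric_generating (S : {fset G}) : Prop :=
  (forall s, s \in S -> (s^-1)%g \in S) /\ (forall g, words S g !=set0).

Definition word_length (R : realType) (S : {fset G}) (g : G) : R :=
  inf [set (size w)%:R | w in words S g].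

End Groups.

Section IsoperimetricProfile.
Context {R : realType} {G : groupType}.
Implicit Types (p : R) (S : {fset G}) (f : G -> R).

Definition supp f : set G := [set g | f g != 0].

(* For finitely supported [f] and [p >= 1] the summands below have finite
   support, so the finitely supported sums are the full sums over [G]. *)
Definition lp_norm p f : R :=
  (\sum_(g \in [set: G]) `|f g| `^ p) `^ p^-1.

Definition lp_grad p S f : R :=
  (\sum_(g \in [set: G]) \sum_(s <- S) `|f (s * g)%g - f g| `^ p) `^ p^-1.

Definition profile_ratio p S f : \bar R :=
  if lp_grad p S f == 0 then +oo%E else (lp_norm p f / lp_grad p S f)%:E.

Definition isoperimetric_profile p S (n : nat) : \bar R :=
  ereal_sup [set profile_ratio p S f | f in
    [set f : G -> R | [/\ finite_set (supp f), supp f !=set0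
                        & (#|` fset_set (supp f)| <= n)%N]]].

End IsoperimetricProfile.

(* [f n = O(g (C n))]; the real number [C n] is rounded down, which amounts to
   extending [g] to the half-line as a step function. *)
Definition asymp_le (R : realType) (f g : nat -> \bar R) : Prop :=
  exists2 C : R, 0 < C & exists2 K : R, 0 < K &
    \forall n \near \oo, (f n <= K%:E * g (Num.truncn (C * n%:R)))%E.

Section Extensions.
Context {R : realType}.
Implicit Type phi : R -> R.

Definition nondecreasing_pos phi : Prop :=
  forall s t, 0 < s -> s <= t -> phi s <= phi t.

(* [phi] is only meaningful on the positive reals; its value at [0] is
   irrelevant for integrability on a set of finite measure. *)
Definition extend0 phi (t : R) : R := if 0 < t then phi t else 0.

(* [phi +oo] is the supremum of [phi]; profiles are positive at every n >= 1,
   hence the value at -oo plays no role. *)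
Definition extend_oo phi (t : \bar R) : \bar R :=
  match t with
  | r%:E => (extend0 phi r)%:E
  | +oo%E => ereal_sup [set (phi s)%:E | s in [set s | 0 < s]]
  | -oo%E => 0%E
  end.

End Extensions.

Definition standard_borel (R : realType) (d : measure_display)
    (T : measurableType d) : Prop :=
  exists (X : metricType R) (f : T -> X),
    [/\ forall F : set_system X, ProperFilter F -> cauchy F ->
          exists x : X, F --> x,
        exists2 D : set X, countable D & dense D,
        bijective f &
        @measurable d T = preimage_set_system setT f <<s @open X >>].

Section Actions.
Context {R : realType} {d : measure_display} {T : measurableType d}.
Context (mu : set T -> \bar R) {G : groupType} (act : G -> T -> T).

Definition is_action : Prop :=
  (forall x, act 1%g x = x) /\
  (forall g h x, act (g * h)%g x = act g (act h x)).

Definition mp_action : Prop := forall g,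
  measurable_fun setT (act g) /\
  (forall A, measurable A -> mu (act g @^-1` A) = mu A).

Definition free_ae : Prop :=
  {ae mu, forall x, forall g, act g x = x -> g = 1%g}.

Definition act_orbit (x : T) : set T := range (fun g => act g x).

Definition fundamental_domain (X : set T) : Prop :=
  measurable X /\ {ae mu, forall x, exists! y, (act_orbit x `&` X) y}.

End Actions.

Record me_coupling (R : realType) (Gamma Lambda : groupType) := MECoupling {
  me_disp : measure_display ;
  me_space : measurableType me_disp ;
  me_mu : {sigma_finite_measure set me_space -> \bar R} ;
  me_actG : Gamma -> me_space -> me_space ;
  me_actL : Lambda -> me_space -> me_space ;
  me_XG : set me_space ;
  me_XL : set me_space ;
  me_standard : standard_borel R me_space ;
  me_mu_neq0 : me_mu setT <> 0%E ;
  me_actionG : is_action me_actG ;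
  me_actionL : is_action me_actL ;
  me_commute : forall g l x, me_actG g (me_actL l x) = me_actL l (me_actG g x) ;
  me_mpG : mp_action me_mu me_actG ;
  me_mpL : mp_action me_mu me_actL ;
  me_freeG : free_ae me_mu me_actG ;
  me_freeL : free_ae me_mu me_actL ;
  me_domG : fundamental_domain me_mu me_actG me_XG ;
  me_domL : fundamental_domain me_mu me_actL me_XL ;
  me_XG_fin : (me_mu me_XG < +oo)%E ;
  me_XL_fin : (me_mu me_XL < +oo)%E
}.

Arguments me_mu {R Gamma Lambda} c : rename.
Arguments me_actG {R Gamma Lambda} c _ _ : rename.
Arguments me_actL {R Gamma Lambda} c _ _ : rename.
Arguments me_XG {R Gamma Lambda} c _ : rename.
Arguments me_XL {R Gamma Lambda} c _ : rename.

Section Cocycle.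
Context {R : realType} {Gamma Lambda : groupType}.
Context (c : me_coupling R Gamma Lambda).

(* The two descriptions below determine a unique element for almost every
   [x] in [me_XL c]; [xget] picks some element on the remaining null set. *)
Definition me_induced (g : Gamma) (x : me_space c) : me_space c :=
  xget x (act_orbit (me_actL c) (me_actG c g x) `&` me_XL c).

Definition me_cocycle (g : Gamma) (x : me_space c) : Lambda :=
  xget 1%g [set l | me_actL c l (me_actG c g x) = me_induced g x].

Definition phi_L0_integrable (SL : {fset Lambda}) (phi : R -> R) : Prop :=
  forall g : Gamma, exists2 cg : R, 0 < cg &
    (\int[me_mu c]_(x in me_XL c)
       (extend0 phi (word_length R SL (me_cocycle g x) / cg))%:E < +oo)%E.

End Cocycle.

(* Main.v *)
Require Import Defs.
From HB Require Import structures.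
From mathcomp Require Import all_boot all_order all_algebra finmap.
From mathcomp Require Import all_classical all_reals all_analysis.
From mathcomp Require Import measurable_realfun.
From mathcomp Require Import lra.
Import Order.TTheory GRing.Theory Num.Theory.
Import numFieldNormedType.Exports.
Local Open Scope classical_set_scope.
Local Open Scope ring_scope.

(** Given a finitely supported [f] on [Lambda], let [F] be the function on the
    coupling space with [F x = f l] when [l] moves [x] into [XL]. The functions
    [h_x g = F (g x)] on [Gamma], for [x] in [XG], satisfy on average
    (unfolding integrals along both fundamental domains)
    - [int_XG ||h_x||^p = mu XL * ||f||^p], and
    - [int_XG ||grad_s h_x||^p = int_XL ||f (alpha (s, x) _) - f||^p],
    the latter being controlled by the integrability of the cocycle [alpha].
    The support of [h_x] is only bounded on average, and the points [x] where it
    is large could a priori carry most of the norm. They do not: with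
    [K x] the number of [g] such that [g x] is in [XL], one has
    [||h_x||^p = sum_l |f l|^p K (l x)], and the functions [K (l _)] are
    uniformly integrable on [XG], because [K] is [Gamma]-invariant and the
    action of [Lambda] preserves the measure. So a set of small measure may be
    discarded, and some remaining [x] has a good isoperimetric ratio. *)

(** * Sums over countable index sets and their integrals *)

Section CountableSums.
Local Open Scope ereal_scope.
Context {R : realType} {I : choiceType}.
Hypothesis countI : countable [set: I].

(** An injection of [I] into [nat] is inverted, with [None] off its range, so finite and infinite
    [I] are treated alike. Theorems on series indexed by [nat], such as termwise integration, thus
    become available for sums over a group. *)
Lemma esum_countable : exists e : nat -> option I,
  forall a : I -> \bar R, (forall i, 0 <= a i) ->
  \esum_(i in [set: I]) a i = \sum_(n <oo) oapp a 0 (e n).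
Proof.
have /countable_injP[g ginj] := countI.
pose e n := if pselect (exists i, g i = n) is left H
            then Some (projT1 (cid H)) else None.
have eg i : e (g i) = Some i.
  rewrite /e; case: pselect => [H|[]]; last by exists i.
  by congr Some; case: cid => j /= /ginj; apply; rewrite inE.
exists e => a a0.
have ea0 n : 0 <= oapp a 0 (e n) by case: (e n) => /=.
rewrite nneseries_esumT//.
rewrite [RHS](_ : _ = \esum_(n in range g) oapp a 0 (e n)).
  rewrite (reindex_esum [set: I] (range g) g).
    by apply: eq_esum => i _; rewrite eg.
  exact: inj_bij.
rewrite [RHS]esum_mkcond; apply: eq_esum => n _.
case: ifPn => // /negP nr; rewrite /e; case: pselect => //= H; case: nr.
by have [i gi] := H; rewrite inE; exists i.
Qed.

Context {d : measure_display} {T : measurableType d}.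
Variables (mu : {measure set T -> \bar R}) (D : set T).
Variable f : I -> T -> \bar R.
Hypothesis f0 : forall i x, 0 <= f i x.
Hypothesis mf : forall i, measurable_fun D (f i).

Lemma measurable_fun_esum :
  measurable_fun D (fun x => \esum_(i in [set: I]) f i x).
Proof.
have [e eE] := esum_countable.
under eq_fun do rewrite eE//.
pose h n x := oapp (fun i => f i x) 0 (e n).
apply: (@ge0_emeasurable_sum _ _ _ _ h xpredT).
  by move=> n x _ _; rewrite /h; case: (e n) => /=.
by move=> n _; rewrite /h; case: (e n) => [i|]/=; [exact: mf|exact: measurable_cst].
Qed.

Lemma ge0_integral_esum : measurable D ->
  \int[mu]_(x in D) (\esum_(i in [set: I]) f i x) =
  \esum_(i in [set: I]) \int[mu]_(x in D) f i x.
Proof.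
move=> mD; have [e eE] := esum_countable.
under eq_integral do rewrite eE//.
rewrite eE; last by move=> i; apply: integral_ge0.
pose h n x := oapp (fun i => f i x) 0 (e n).
rewrite (@integral_nneseries _ _ _ mu D mD h).
- apply: eq_eseriesr => n _; rewrite /h; case: (e n) => [i|]//=.
  exact: integral0.
- by move=> n; rewrite /h; case: (e n) => [i|]/=; [exact: mf|exact: measurable_cst].
- by move=> n x _; rewrite /h; case: (e n) => /=.
Qed.

End CountableSums.

Lemma ae_forall_countable {d} {T : measurableType d} {R : realType}
    (mu : {measure set T -> \bar R}) (I : Type) (P : I -> T -> Prop) :
  countable [set: I] -> (forall i, {ae mu, forall x, P i x}) ->
  {ae mu, forall x, forall i, P i x}.
Proof.
move=> /countable_injP[g ginj] aeP.
have : {ae mu, forall x, forall n, forall i, g i = n -> P i x}.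
  apply: ae_foralln => n.
  have [[i gi]|ni] := pselect (exists i, g i = n); last first.
    by apply: aeW => x i gi; exfalso; apply: ni; exists i.
  apply: filterS (aeP i) => x Pix j gj.
  by have <- : i = j by apply: ginj; rewrite ?inE// gi gj.
by apply: filterS => x Px i; exact: (Px (g i)).
Qed.

(** Every element is the product of a word over the finite type [S], and there are countably many
    such words. *)
Lemma symmetric_generating_countable {G : groupType} (S : {fset G}) :
  symmetric_generating S -> countable [set: G].
Proof.
move=> [_ gen].
have -> : [set: G] = (fun w : seq S => (\prod_(s <- map val w) s)%g) @` setT.
  apply/seteqP; split=> // g _; have [w [wS <-]] := gen g.
  have [v ->] : exists v : seq S, w = map val v.
    elim: w wS => [|x w IH] wS; first by exists [::].
    have [|v ->] := IH; first by move=> y yw; apply: wS; rewrite inE yw orbT.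
    have xS : x \in S by apply: wS; rewrite inE eqxx.
    by exists ([` xS]%fset :: v).
  by exists v.
apply: card_le_trans (countableP [set: seq S]); exact: card_image_le.
Qed.

Section Esum.
Local Open Scope ereal_scope.
Context {R : realType} {I : choiceType}.

Lemma esum_single (i0 : I) (a : I -> \bar R) :
  (forall i, i != i0 -> a i = 0) -> 0 <= a i0 ->
  \esum_(i in [set: I]) a i = a i0.
Proof.
move=> az a0; rewrite -(esum_set1 a0) [RHS]esum_mkcond; apply: eq_esum => i _.
case: ifPn => [//|]; rewrite notin_setE /= => /eqP; exact: az.
Qed.

Lemma reindex_esumT {J : choiceType} (e : J -> I) (a : I -> \bar R) :
  bijective e -> \esum_(i in [set: I]) a i = \esum_(j in [set: J]) a (e j).
Proof. by move=> be; apply: (reindex_esum [set: J] [set: I] e); rewrite setTT_bijective. Qed.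

End Esum.

(** * Measure-preserving actions and unfolding along a fundamental domain *)

Section MeasurePreservingActions.
Local Open Scope ereal_scope.
Context {R : realType} {d : measure_display} {T : measurableType d}.
Context {mu : {measure set T -> \bar R}} {G : groupType} {act : G -> T -> T}.
Hypothesis countG : countable [set: G].
Hypothesis actP : is_action act.
Hypothesis mpP : mp_action mu act.

Lemma act_measurable g : measurable_fun setT (act g).
Proof. exact: (mpP g).1. Qed.

Lemma actK g x : act (g^-1)%g (act g x) = x.
Proof. by rewrite -actP.2 mulVg actP.1. Qed.

Lemma actKV g x : act g (act (g^-1)%g x) = x.
Proof. by rewrite -actP.2 mulgV actP.1. Qed.

Lemma act_preimage_measurable g A : measurable A -> measurable (act g @^-1` A).
Proof. by move=> mA; rewrite -[X in measurable X]setTI; exact: act_measurable. Qed.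

Lemma measurable_fun_act (d' : measure_display) (U : measurableType d')
    (H : T -> U) g :
  measurable_fun setT H -> measurable_fun setT (fun x => H (act g x)).
Proof. by move=> mH; apply: measurableT_comp mH _; exact: act_measurable. Qed.

Lemma ge0_integral_act g (H : T -> \bar R) : measurable_fun setT H ->
  (forall x, 0 <= H x) -> \int[mu]_x H (act g x) = \int[mu]_x H x.
Proof.
move=> mH H0; have mg := act_measurable g.
have := @ge0_integral_pushforward _ _ _ _ _ _ mg mu setT H measurableT mH _.
rewrite preimage_setT => <-; last by move=> x _; exact: H0.
by apply: eq_measure_integral => A mA _; exact: (mpP g).2.
Qed.

(** The preimages of a null set under the countably many group elements are null, and so is their
    union. *)
Lemma ae_act (P : T -> Prop) :
  {ae mu, forall x, P x} -> {ae mu, forall x, forall g, P (act g x)}.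
Proof.
move=> [N [mN N0 PN]]; apply: ae_forall_countable => // g.
exists (act g @^-1` N); split; first exact: act_preimage_measurable.
  by rewrite /= (mpP g).2.
by move=> x /= nP; apply: PN.
Qed.

(** Freeness turns uniqueness of the orbit point in [X] into uniqueness of the group element that
    reaches it. *)
Lemma fundamental_domain_hit (X : set T) :
  free_ae mu act -> fundamental_domain mu act X ->
  {ae mu, forall x, exists! g, X (act g x)}.
Proof.
move=> fr [_ dom]; apply: filterS2 fr dom => x frx [y [[[g _ gx] Xy] uy]].
exists g; split; first by rewrite gx.
move=> g' Xg'; have yg' : y = act g' x by apply: uy; split => //; exists g'.
have : act (g^-1 * g')%g x = x by rewrite actP.2 -yg' -gx actK.
by move=> /frx /(congr1 (fun h => g * h)%g); rewrite mulVKg mulg1.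
Qed.

Context {X : set T}.
Hypothesis mX : measurable X.
Hypothesis hitX : {ae mu, forall x, exists! g, X (act g x)}.

Lemma esum_hit (a : G -> \bar R) g x : (forall h, 0 <= a h) ->
  X (act g x) -> (forall h, X (act h x) -> g = h) ->
  \esum_(h in [set: G]) (a h * (\1_X (act h x))%:E) = a g.
Proof.
move=> a0 Xg ug; rewrite (esum_single g).
- by rewrite indicE mem_set// mule1.
- move=> h hg; rewrite indicE memNset ?mule0// => /ug gh.
  by rewrite gh eqxx in hg.
- by rewrite mule_ge0.
Qed.

(** Almost everywhere, the sum over [g] of the indicators of [X] at [act g x] is 1. Insert it,
    exchange sum and integral, replace [g] by its inverse, and substitute [act g x] for [x] in the
    term of index [g]. *)
Lemma ge0_integral_unfold (H : T -> \bar R) : measurable_fun setT H ->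
  (forall x, 0 <= H x) ->
  \int[mu]_x H x = \int[mu]_(x in X) \esum_(g in [set: G]) H (act g x).
Proof.
move=> mH H0.
have mI g : measurable_fun setT (fun x => (\1_X (act g x))%:E : \bar R).
  by apply/measurable_EFinP; apply: measurable_fun_act; exact: measurable_indic.
have mHI g h : measurable_fun setT (fun x => H (act h x) * (\1_X (act g x))%:E).
  by apply: emeasurable_funM => //; exact: measurable_fun_act.
have HI0 g h x : 0 <= H (act h x) * (\1_X (act g x))%:E by rewrite mule_ge0.
transitivity (\int[mu]_x \esum_(g in [set: G]) (H (act 1%g x) * (\1_X (act g x))%:E)).
  apply: ge0_ae_eq_integral => //.
  - exact: measurable_fun_esum.
  - by move=> x _; apply: esum_ge0.
  - apply: filterS hitX => x [g [Xg ug]] _.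
    by rewrite (@esum_hit (fun=> H (act 1%g x)) g) ?actP.1.
rewrite ge0_integral_esum//.
rewrite (reindex_esumT (fun g : G => (g^-1)%g)); last first.
  by exists (fun g => (g^-1)%g) => g; rewrite invgK.
transitivity (\esum_(g in [set: G]) \int[mu]_x (H (act g x) * (\1_X (act 1%g x))%:E)).
  apply: eq_esum => g _; rewrite -(ge0_integral_act g)//.
  by apply: eq_integral => x _; rewrite !actP.1 actK.
rewrite ge0_integral_esum//; last first.
  by move=> g; apply/measurable_funTS/measurable_fun_act.
apply: eq_esum => g _; rewrite [RHS]integral_mkcond.
by rewrite epatch_indic; apply: eq_integral => x _; rewrite actP.1.
Qed.

End MeasurePreservingActions.

(** * Real-valued sums, counting, and comparison of integrals *)

Section EsumReal.
Local Open Scope ereal_scope.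
Context {R : realType} {I : choiceType}.

Lemma ge0_esumZl (k : R) (a : I -> \bar R) : countable [set: I] ->
  (0 <= k)%R -> (forall i, 0 <= a i) ->
  \esum_(i in [set: I]) (k%:E * a i) = k%:E * \esum_(i in [set: I]) a i.
Proof.
move=> /(@esum_countable R)[e eE] k0 a0.
rewrite !eE// => [|i]; last by rewrite mule_ge0.
rewrite -nneseriesZl => [|n _]; last by case: (e n) => /=.
by apply: eq_eseriesr => n _; case: (e n) => //=; rewrite mule0.
Qed.

Lemma esum_fsbig (a : I -> R) : (forall i, 0 <= a i)%R ->
  finite_set [set i | a i != 0%R] ->
  \esum_(i in [set: I]) (a i)%:E = (\sum_(i \in [set: I]) a i)%:E.
Proof.
move=> a0 fa; rewrite [in RHS]fsbig_supp.
have -> : [set: I] `&` a @^-1` [set~ 0%R] = [set i | a i != 0%R].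
  by apply/seteqP; split=> i /=; [move=> [_ /eqP]|move=> /eqP].
rewrite -fsumEFin// -(esum_fset fa); last by move=> i _; rewrite lee_fin.
rewrite [RHS]esum_mkcond; apply: eq_esum => i _.
by case: ifPn => //; rewrite notin_setE /= => /negP /negPn /eqP ->.
Qed.

(** Markov's inequality for the counting measure. It is first applied to finite subsets of [A]; an
    infinite [A] would contain one with more than [N] elements. *)
Lemma esum_card_le (a : I -> \bar R) (A : set I) N : (forall i, 0 <= a i) ->
  (forall i, A i -> 1 <= a i) -> \esum_(i in [set: I]) a i <= N%:R%:E ->
  finite_set A /\ (#|` fset_set A| <= N)%N.
Proof.
move=> a0 a1 aN.
have key (F : {fset I}) : [set` F] `<=` A -> (#|` F| <= N)%N.
  move=> FA; rewrite -(ler_nat R) -lee_fin; apply: le_trans aN.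
  apply: (@le_trans _ _ (\sum_(i <- F) a i)).
    rewrite (_ : #|` F|%:R%:E = \sum_(i <- F) (1 : \bar R)); last first.
      by rewrite sumEFin big_const_seq count_predT iter_addr_0.
    by rewrite !big_seq; apply: lee_sum => i iF; apply/a1/FA.
  apply: esum_ge; exists [set` F]; first by split => //; exact: finite_fset.
  by rewrite fsbig_finite ?set_fsetK//; exact: finite_fset.
have finA : finite_set A.
  apply: contrapT => /(infinite_set_fset N.+1)[F FA].
  by rewrite ltnNge key.
by split=> //; apply: key; rewrite fset_setK.
Qed.

End EsumReal.

Section Integrals.
Local Open Scope ereal_scope.
Context {d : measure_display} {T : measurableType d} {R : realType}.
Variables (mu : {measure set T -> \bar R}) (D : set T).
Hypothesis mD : measurable D.

(* [h] need not be measurable, so its integral is a lower integral. *)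
Lemma ae_le_lower_integral (f h : T -> \bar R) : measurable_fun D f ->
  (forall x, 0 <= f x) -> (forall x, 0 <= h x) ->
  {ae mu, forall x, D x -> f x <= h x} ->
  \int[mu]_(x in D) f x <= \int[mu]_(x in D) h x.
Proof.
move=> mf f0 h0 [N [mN N0 fhN]].
rewrite (ge0_negligible_integral mN)//.
rewrite !ge0_integralE//; apply: ereal_sup_le => _ [u /= uf <-].
exists u => //= x; apply: le_trans (uf x) _; rewrite !patchE.
case: ifPn => [|_]; last by case: ifPn.
rewrite inE => -[Dx Nx]; rewrite mem_set//.
by apply: contrapT => fh; apply/Nx/fhN => /= /(_ Dx).
Qed.

Lemma lt_integral_exists (f h : T -> \bar R) : measurable_fun D f ->
  measurable_fun D h ->
  (forall x, 0 <= f x) ->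
  \int[mu]_(x in D) h x < \int[mu]_(x in D) f x ->
  exists2 x, D x & h x < f x.
Proof.
move=> mf mh f0; apply: contraPP => /forall2NP fh; apply/negP; rewrite -leNgt.
apply: ge0_le_integral => // x Dx; rewrite leNgt; apply/negP.
by case: (fh x).
Qed.

End Integrals.

(** * Norms and gradients of finitely supported functions *)

Section FiniteSupport.
Context {R : realType} {G : groupType}.
Implicit Types (p : R) (S : {fset G}) (f : G -> R).

(** With [grad_sum], the [p]-th powers of [lp_norm] and [lp_grad]. These are what integrals over the
    coupling produce; roots are dealt with only in [le_profile_ratioP]. *)
Definition norm_sum p f : R := \sum_(g \in [set: G]) `|f g| `^ p.

Definition grad_sum p S f : R :=
  \sum_(g \in [set: G]) \sum_(s <- S) `|f (s * g)%g - f g| `^ p.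

Lemma norm_sum_ge0 p f : 0 <= norm_sum p f.
Proof. by apply: fsumr_ge0 => g _; exact: powR_ge0. Qed.

Lemma grad_sum_ge0 p S f : 0 <= grad_sum p S f.
Proof. by apply: fsumr_ge0 => g _; apply: sumr_ge0 => s _; exact: powR_ge0. Qed.

Lemma finite_supp_translate f (a : G) :
  finite_set (supp f) -> finite_set (supp (fun g => f (a * g)%g)).
Proof.
move=> ff; apply: sub_finite_set (finite_image (fun g => a^-1 * g)%g ff).
by move=> g /= fg; exists (a * g)%g => //; rewrite mulKg.
Qed.

Lemma finite_supp_diff p f (a : G) : p != 0 -> finite_set (supp f) ->
  finite_set [set g | `|f (a * g)%g - f g| `^ p != 0].
Proof.
move=> p0 ff; have fa := finite_supp_translate f a ff.
have fU : finite_set (supp (fun g => f (a * g)%g) `|` supp f) by rewrite finite_setU.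
apply: sub_finite_set fU => g /=; rewrite powR_eq0 p0 andbT normr_eq0 => fg.
have [fg0|] := eqVneq (f g) 0; last by right.
by left; rewrite /supp /=; rewrite fg0 subr0 in fg.
Qed.

Lemma norm_sumE p f : p != 0 -> finite_set (supp f) ->
  (norm_sum p f)%:E = (\esum_(g in [set: G]) (`|f g| `^ p)%:E)%E.
Proof.
move=> p0 ff; rewrite esum_fsbig//.
apply: sub_finite_set ff => g /=.
by rewrite powR_eq0 p0 andbT normr_eq0.
Qed.

Lemma norm_sum_fset p f : p != 0 -> finite_set (supp f) ->
  norm_sum p f = \sum_(g <- fset_set (supp f)) `|f g| `^ p.
Proof.
move=> p0 ff; rewrite -fsbig_finite// /norm_sum [LHS]fsbig_supp; congr (\sum_(g \in _) _).
apply/seteqP; split=> g /=; rewrite /supp /=.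
  by move=> [_ /eqP]; rewrite powR_eq0 p0 andbT normr_eq0.
by move=> fg; split => //; apply/eqP; rewrite powR_eq0 p0 andbT normr_eq0.
Qed.

Lemma grad_sumE p S f : p != 0 -> finite_set (supp f) -> (grad_sum p S f)%:E =
  (\sum_(s <- S) \esum_(g in [set: G]) (`|f (s * g)%g - f g| `^ p)%:E)%E.
Proof.
move=> p0 ff; rewrite -esum_sum; last by move=> g s _ _; rewrite lee_fin powR_ge0.
rewrite -esum_fsbig.
- by apply: eq_esum => g _; rewrite sumEFin.
- by move=> g; apply: sumr_ge0 => s _; exact: powR_ge0.
have fS : finite_set (\bigcup_(s in [set` S]) [set g | `|f (s * g)%g - f g| `^ p != 0]).
  by apply: bigcup_finite => [|s _]; [exact: finite_fset|exact: finite_supp_diff].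
apply: sub_finite_set fS => g /= ng; apply: contrapT => H; move: ng.
rewrite big_seq big1 ?eqxx// => s sS; apply/eqP/negPn/negP => nz; apply: H.
by exists s.
Qed.

Lemma norm_sum_gt0 p f : p != 0 -> finite_set (supp f) -> supp f !=set0 ->
  0 < norm_sum p f.
Proof.
move=> p0 ff [g fg]; rewrite norm_sum_fset//.
have gf : g \in fset_set (supp f) by rewrite in_fset_set// inE.
rewrite (bigD1_seq g) ?fset_uniq//= ltr_pwDl//.
  by rewrite lt0r powR_ge0 powR_eq0 p0 andbT normr_eq0 andbT.
by apply: sumr_ge0 => h _; exact: powR_ge0.
Qed.

End FiniteSupport.

(** * Visits of [Gamma]-orbits to the fundamental domain of [Lambda] *)

Section Coupling.
Local Open Scope ereal_scope.
Context {R : realType} {Gamma Lambda : groupType}.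
Context (c : me_coupling R Gamma Lambda).
Hypothesis countG : countable [set: Gamma].
Hypothesis countL : countable [set: Lambda].

Local Notation mu := (me_mu c).
Local Notation aG := (me_actG c).
Local Notation aL := (me_actL c).
Local Notation XG := (me_XG c).
Local Notation XL := (me_XL c).

Let mXG : measurable XG := (me_domG c).1.
Let mXL : measurable XL := (me_domL c).1.

Let hitG : {ae mu, forall x, exists! g, XG (aG g x)}.
Proof. exact: fundamental_domain_hit (me_actionG c) _ (me_freeG c) (me_domG c). Qed.

Let hitL : {ae mu, forall x, exists! l, XL (aL l x)}.
Proof. exact: fundamental_domain_hit (me_actionL c) _ (me_freeL c) (me_domL c). Qed.

Let unfoldG := ge0_integral_unfold countG (me_actionG c) (me_mpG c) mXG hitG.
Let unfoldL := ge0_integral_unfold countL (me_actionL c) (me_mpL c) mXL hitL.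

(** Almost every point has a [Lambda]-translate in [XL]; if [XL] were null, the whole space would be
    null. *)
Lemma coupling_XL_gt0 : 0 < mu XL.
Proof.
rewrite lt0e measure_ge0 andbT; apply/eqP => XL0; apply: (@me_mu_neq0 _ _ _ c).
have : {ae mu, forall x, ~ XL x} by exists XL; split => // x /= /contrapT.
move=> /(ae_act countL (me_mpL c)) nXL.
have [N [mN N0 TN]] : {ae mu, forall x : me_space c, False}.
  by apply: filterS2 nXL hitL => x nx [l [/nx]].
apply/eqP; rewrite -measure_le0 -N0 le_measure ?inE// => x _.
by apply: TN => /=; exact: id.
Qed.

(** The count [K] of the overview, with extended values because it may be infinite on a null set. *)
Definition visits (x : me_space c) : \bar R :=
  \esum_(g in [set: Gamma]) (\1_XL (aG g x))%:E.

Lemma visits_ge0 x : 0 <= visits x.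
Proof. by apply: esum_ge0 => g _; rewrite lee_fin. Qed.

Lemma measurable_visits : measurable_fun setT visits.
Proof.
apply: measurable_fun_esum => //.
move=> g; apply/measurable_EFinP.
by apply: (measurable_fun_act (me_mpG c)); exact: measurable_indic.
Qed.

Lemma visits_act g x : visits (aG g x) = visits x.
Proof.
rewrite /visits (reindex_esumT (fun h => h * g^-1)%g); last first.
  by exists (fun h => h * g)%g => h; rewrite ?mulgVK ?mulgK.
apply: eq_esum => h _.
by rewrite -(me_actionG c).2 mulgVK.
Qed.

(** Translate the indicator of [XL] intersected with [Z] by [l] and unfold it along [XG]. As [Z] is
    [Gamma]-invariant and the actions commute, its indicator factors out of the sum over [Gamma],
    which leaves [visits]. *)
Lemma integral_visits_indic (Z : set (me_space c)) l : measurable Z ->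
  (forall g x, Z (aG g x) <-> Z x) ->
  \int[mu]_(x in XG) (visits (aL l x) * (\1_Z (aL l x))%:E) = mu (XL `&` Z).
Proof.
move=> mZ invZ; rewrite -[X in mu X]setIT -integral_indic//; last exact: measurableI.
rewrite -(ge0_integral_act (me_mpL c) l)//; last first.
  by apply/measurable_EFinP/measurable_indic; exact: measurableI.
rewrite unfoldG//; last first.
  apply/measurable_EFinP; apply: (measurable_fun_act (me_mpL c)).
  by apply: measurable_indic; exact: measurableI.
apply: eq_integral => x _.
have ZE g : (\1_Z (aL l (aG g x)) : R) = \1_Z (aL l x).
  rewrite !indicE -me_commute; congr ((nat_of_bool _)%:R).
  by apply/idP/idP; rewrite !inE => /invZ.
have [Zx|nZx] := pselect (Z (aL l x)).
  have Z1 : (\1_Z (aL l x) : R) = 1%R by rewrite indicE mem_set.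
  rewrite Z1 mule1; apply: eq_esum => g _.
  by rewrite indicI /= ZE Z1 mulr1 me_commute.
have Z0 : (\1_Z (aL l x) : R) = 0%R by rewrite indicE memNset.
rewrite Z0 mule0 esum1// => g _.
by rewrite indicI /= ZE Z0 mulr0.
Qed.

Lemma measurable_visits_actL l : measurable_fun setT (fun x => visits (aL l x)).
Proof. exact: (measurable_fun_act (me_mpL c)) measurable_visits. Qed.

Lemma integral_visits l : \int[mu]_(x in XG) visits (aL l x) = mu XL.
Proof.
rewrite -[X in _ = mu X]setIT -(integral_visits_indic _ l)//.
by apply: eq_integral => x _; rewrite indicT mule1.
Qed.

(** Integrability gives finiteness almost everywhere on [XG]; invariance of [visits] carries it to
    the [Gamma]-translates of [XG], which cover almost everything. *)
Lemma visits_fin_num : {ae mu, forall x, visits x \is a fin_num}.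
Proof.
have iv : mu.-integrable XG visits.
  apply/integrableP; split; first exact: measurable_funTS measurable_visits.
  under eq_integral do rewrite gee0_abs ?visits_ge0//.
  rewrite (_ : \int[mu]_(x in XG) _ = mu XL) ?me_XL_fin//.
  rewrite -(integral_visits 1%g).
  by apply: eq_integral => x _; rewrite (me_actionL c).1.
have := integrable_ae mXG iv.
move=> /(ae_act countG (me_mpG c)); apply: filterS2 hitG => x [g [Xg _]] /(_ g Xg).
by rewrite visits_act.
Qed.

(** * Uniform integrability of the visit counts *)

Definition often (n : nat) : set (me_space c) := [set x | n%:R%:E < visits x].

Lemma measurable_often n : measurable (often n).
Proof.
by rewrite -[often n]setTI; exact: emeasurable_fun_o_infty measurable_visits _.
Qed.

(** Within [XL], which has finite measure, these sets decrease to a null set by [visits_fin_num];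
    continuity from above applies. *)
Lemma measure_often_small (e : R) : (0 < e)%R ->
  exists n, mu (XL `&` often n) <= e%:E.
Proof.
move=> e0; apply: contrapT => /forallNP H.
have mF n : measurable (XL `&` often n).
  by apply: measurableI => //; exact: measurable_often.
have mcap : measurable (\bigcap_n (XL `&` often n)) by exact: bigcapT_measurable.
have cap0 : mu (\bigcap_n (XL `&` often n)) = 0.
  apply/negligibleP => //; apply: negligibleS visits_fin_num => x Fx /= finx.
  have [_ /=] := Fx (Num.truncn (fine (visits x))).+1 I.
  rewrite /often /= -[visits x]fineK// lte_fin fineK// => /ltW.
  by rewrite leNgt truncnS_gt.
have cv : (fun n => mu (XL `&` often n)) @ \oo --> 0.
  rewrite -cap0; apply: nonincreasing_cvg_mu => //.
    by apply: le_lt_trans (me_XL_fin c); rewrite le_measure ?inE//; exact: subIsetl.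
  move=> i j ij; apply/subsetPset; apply: setIS => x; rewrite /often /=.
  by apply: le_lt_trans; rewrite lee_fin ler_nat.
have : e%:E <= limn (fun n => mu (XL `&` often n)).
  apply: lime_ge; first by apply/cvg_ex; exists 0.
  by apply: nearW => n; apply/ltW; rewrite ltNge; apply/negP/H.
by rewrite (cvg_lim _ cv)// leNgt lte_fin e0.
Qed.

Let m := fine (mu XL).

Lemma measure_XLE : mu XL = m%:E.
Proof. by rewrite /m fineK// ge0_fin_numE ?me_XL_fin. Qed.

Lemma measure_XL_gt0 : (0 < m)%R.
Proof. by rewrite -lte_fin -measure_XLE coupling_XL_gt0. Qed.

(* Off this set, [transfer_supp] bounds the support of the transferred function. *)
Definition crowded (M : nat) (A : seq Lambda) : set (me_space c) :=
  [set x | (M * size A)%:R%:E < \sum_(l <- A) visits (aL l x)].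

Lemma measurable_crowded M A : measurable (crowded M A).
Proof.
rewrite -[crowded M A]setTI; apply: emeasurable_fun_o_infty => //.
by apply: emeasurable_sum => l; exact: measurable_visits_actL.
Qed.

(** Markov's inequality: each of the [size A] summands has integral [m] over [XG]. *)
Lemma measure_crowded M A : (0 < M)%N -> (0 < size A)%N ->
  mu (XG `&` crowded M A) <= (m / M%:R)%:E.
Proof.
move=> M0 A0.
have mB : measurable (XG `&` crowded M A).
  by apply: measurableI => //; exact: measurable_crowded.
have MA0 : (0 < (M * size A)%:R :> R)%R by rewrite ltr0n muln_gt0 M0.
have ms : measurable_fun setT (fun x => \sum_(l <- A) visits (aL l x)).
  by apply: emeasurable_sum => l; exact: measurable_visits_actL.
have s0 x : 0 <= \sum_(l <- A) visits (aL l x).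
  by apply: sume_ge0 => l _; exact: visits_ge0.
have : (M * size A)%:R%:E * mu (XG `&` crowded M A) <= ((size A)%:R * m)%:E.
  rewrite -integral_cst//.
  apply: (@le_trans _ _ (\int[mu]_(x in XG) \sum_(l <- A) visits (aL l x))).
    apply: (@le_trans _ _ (\int[mu]_(x in XG `&` crowded M A) \sum_(l <- A) visits (aL l x))).
      apply: ge0_le_integral => //.
      - by move=> x _; rewrite lee_fin ltW.
      - exact: measurable_funTS.
      - by move=> x [_ /ltW].
    apply: ge0_subset_integral => //; exact: measurable_funTS.
  rewrite ge0_integral_sum//; last 2 first.
  - by move=> l; apply: measurable_funTS; exact: measurable_visits_actL.
  - by move=> l x _; exact: visits_ge0.
  under eq_bigr do rewrite integral_visits measure_XLE.
  rewrite sumEFin big_const_seq count_predT iter_addr_0.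
  by rewrite mulr_natl.
rewrite -lee_pdivlMl// => /le_trans; apply.
rewrite -EFinM lee_fin natrM invfM -mulrA mulKf ?pnatr_eq0 -?lt0n//.
by rewrite mulrC.
Qed.

(** The point is that [M] depends neither on [A] nor on [l]. Split [visits] at a level [n]: the
    values up to [n] contribute at most [n] times the measure of the crowded set, the larger ones at
    most the measure of [often n] in [XL]. Each part is at most [m / 4]. *)
Lemma integral_visits_crowded : exists2 M, (0 < M)%N & forall A l,
  (0 < size A)%N ->
  \int[mu]_(x in XG `&` crowded M A) visits (aL l x) <= (m / 2)%:E.
Proof.
have m0 := measure_XL_gt0.
have [n nP] : exists n, mu (XL `&` often n) <= (m / 4)%:E.
  by apply: measure_often_small; rewrite divr_gt0.
(* By [measure_crowded], this factor gives [n * (m / M) <= m / 4]; the successor keeps it positive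
   when [n] is 0. *)
exists (4 * n.+1)%N => // A l A0.
set B := XG `&` _.
have mB : measurable B.
  by apply: measurableI => //; exact: measurable_crowded.
have mO : measurable_fun setT
    (fun x => visits (aL l x) * (\1_(often n) (aL l x))%:E).
  apply: emeasurable_funM; first exact: measurable_visits_actL.
  apply/measurable_EFinP; apply: (measurable_fun_act (me_mpL c)).
  by apply: measurable_indic; exact: measurable_often.
have O0 x : 0 <= visits (aL l x) * (\1_(often n) (aL l x))%:E.
  by rewrite mule_ge0 ?visits_ge0.
apply: (@le_trans _ _ (\int[mu]_(x in B)
    (n%:R%:E + visits (aL l x) * (\1_(often n) (aL l x))%:E))).
  apply: ge0_le_integral => //.
  - by move=> x _; exact: visits_ge0.
  - by apply: measurable_funTS; exact: measurable_visits_actL.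
  - by apply: measurable_funTS; apply: emeasurable_funD.
  - move=> x _; rewrite indicE; have [xO|xO] := boolP (aL l x \in often n).
      by rewrite mule1 leeDr// lee_fin.
    by rewrite mule0 adde0 leNgt; apply: contraNN xO; rewrite inE.
rewrite ge0_integralD//; last exact: measurable_funTS.
rewrite integral_cst//.
rewrite [leRHS](_ : _ = (m / 4)%:E + (m / 4)%:E); last first.
  by rewrite -EFinD; congr (_%:E); lra.
apply: leeD.
  apply: (@le_trans _ _ (n%:R%:E * (m / (4 * n.+1)%:R)%:E)).
    by rewrite lee_wpmul2l// ?lee_fin// measure_crowded.
  rewrite -EFinM lee_fin natrM invfM mulrCA ler_pM2l// mulrCA ger_pMr ?invr_gt0//.
  by rewrite ler_pdivrMr ?ltr0n// mul1r ler_nat.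
apply: le_trans nP; rewrite -(integral_visits_indic _ l); last 2 first.
- exact: measurable_often.
- by move=> g x; rewrite /often /= visits_act.
by apply: ge0_subset_integral => //; [exact: measurable_funTS|exact: subIsetl].
Qed.

(** * Transfer of functions from [Lambda] to [Gamma] *)

Lemma sum_hit (A : {fset Lambda}) (u : Lambda -> R) l x :
  (forall k, k \notin A -> u k = 0%R) ->
  XL (aL l x) -> (forall k, XL (aL k x) -> l = k) ->
  (\sum_(k <- A) u k * \1_XL (aL k x))%R = u l.
Proof.
move=> u0 Xl ul; have miss k : k != l -> (\1_XL (aL k x) : R) = 0%R.
  by move=> kl; rewrite indicE memNset// => /ul lk; rewrite lk eqxx in kl.
have [lA|lA] := boolP (l \in A).
  rewrite (bigD1_seq l) ?fset_uniq//= big1 => [|k kl]; last by rewrite miss ?mulr0.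
  by rewrite indicE mem_set// mulr1 addr0.
rewrite u0// big_seq big1// => k kA; rewrite miss ?mulr0//.
by apply: contraNneq lA => <-.
Qed.

(** The function [F] of the overview. Written as a sum of indicators it is defined everywhere, also
    where no [l] or several [l] move [x] into [XL], and its measurability is immediate. *)
Definition transfer (f : Lambda -> R) (x : me_space c) : R :=
  (\sum_(l <- fset_set (supp f)) f l * \1_XL (aL l x))%R.

Lemma measurable_transfer f : measurable_fun setT (transfer f).
Proof.
apply: measurable_sum => l; apply: measurable_funM => //.
by apply: (measurable_fun_act (me_mpL c)); exact: measurable_indic.
Qed.

Section Transfer.
Variables (p : R) (f : Lambda -> R).
Hypothesis p1 : (1 <= p)%R.
Hypothesis finf : finite_set (supp f).

Let p0 : p != 0%R.
Proof. by rewrite gt_eqF// (lt_le_trans ltr01). Qed.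

Let A := fset_set (supp f).

Let notinA k : k \notin A -> f k = 0%R.
Proof. by rewrite in_fset_set// notin_setE /supp /= => /negP /negPn /eqP. Qed.

Lemma transfer_hit l x :
  XL (aL l x) -> (forall k, XL (aL k x) -> l = k) -> transfer f x = f l.
Proof. by apply: sum_hit => k; exact: notinA. Qed.

(** Almost everywhere a single [l] contributes to [transfer], so the power passes inside the sum;
    summing over [g] then turns indicators into [visits]. The set [B] will be [XG] or its crowded
    part. *)
Lemma integral_transfer_norm (B : set (me_space c)) : measurable B ->
  \int[mu]_(x in B) (\esum_(g in [set: Gamma]) (`|transfer f (aG g x)| `^ p)%:E) =
  \sum_(l <- A) ((`|f l| `^ p)%:E * \int[mu]_(x in B) visits (aL l x)).
Proof.
move=> mB.
have mt g : measurable_fun setT (fun x => (`|transfer f (aG g x)| `^ p)%:E : \bar R).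
  apply/measurable_EFinP; apply: (measurableT_comp (measurable_powR p)).
  apply: measurableT_comp => //.
  exact: (measurable_fun_act (me_mpG c)) (measurable_transfer f).
have mv l : measurable_fun B (fun x => visits (aL l x)).
  by apply: measurable_funTS; exact: measurable_visits_actL.
transitivity (\int[mu]_(x in B) (\sum_(l <- A) ((`|f l| `^ p)%:E * visits (aL l x)))).
  apply: ge0_ae_eq_integral => //.
  - by apply: measurable_fun_esum => // g; exact: measurable_funTS.
  - by apply: emeasurable_sum => l; exact: emeasurable_funM.
  - by move=> x _; apply: esum_ge0 => g _; rewrite lee_fin powR_ge0.
  - move=> x _; apply: sume_ge0 => l _.
    by rewrite mule_ge0 ?visits_ge0// lee_fin powR_ge0.
  have := ae_act countG (me_mpG c) _ hitL; apply: filterS => x hx _.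
  transitivity (\esum_(g in [set: Gamma])
      \sum_(l <- A) (`|f l| `^ p * \1_XL (aL l (aG g x)))%:E).
    apply: eq_esum => g _; have [l [Xl ul]] := hx g.
    rewrite sumEFin (transfer_hit l)// (@sum_hit A (fun l => `|f l| `^ p)%R l)// => k kA.
    by rewrite notinA// normr0 powR0.
  rewrite esum_sum; last by move=> g l _ _; rewrite lee_fin mulr_ge0 ?powR_ge0.
  apply: eq_bigr => l _; rewrite -ge0_esumZl ?powR_ge0//.
  by apply: eq_esum => g _; rewrite me_commute.
rewrite ge0_integral_sum//; last 2 first.
- by move=> l; exact: emeasurable_funM.
- by move=> l x _; rewrite mule_ge0 ?visits_ge0// lee_fin powR_ge0.
apply: eq_bigr => l _; rewrite ge0_integralZl_EFin ?powR_ge0//.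
by move=> x _; exact: visits_ge0.
Qed.

Lemma me_cocycle_hit s x : (exists l, XL (aL l (aG s x))) ->
  XL (aL (me_cocycle s x) (aG s x)).
Proof.
move=> [l Xl].
have [[k _ kE] Xi] : (act_orbit aL (aG s x) `&` XL) (me_induced s x).
  by apply: xgetPex; exists (aL l (aG s x)); split => //; exists l.
rewrite (_ : aL _ _ = me_induced s x)//.
have := @xgetPex _ 1%g [set l | aL l (aG s x) = me_induced s x].
by apply; exists k.
Qed.

(** Fold the left side back to an integral over the whole space, then unfold it along [XL]. Over a
    point [x] of [XL], the sum over [Lambda] compares [f] with its translate by the cocycle, which
    is where the bound by [psi] enters. *)
Lemma integral_transfer_grad s (t : R) (psi : Lambda -> R) :
  (0 <= t)%R -> (forall a, 0 <= psi a)%R ->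
  (forall a, \esum_(l in [set: Lambda]) (`|f (a * l)%g - f l| `^ p)%:E <=
             (t * psi a)%:E) ->
  \int[mu]_(x in XG) (\esum_(g in [set: Gamma])
     (`|transfer f (aG s (aG g x)) - transfer f (aG g x)| `^ p)%:E) <=
  t%:E * \int[mu]_(x in XL) (psi (me_cocycle s x))%:E.
Proof.
move=> t0 psi0 fpsi.
pose H x : \bar R := (`|transfer f (aG s x) - transfer f x| `^ p)%:E.
have mH : measurable_fun setT H.
  apply/measurable_EFinP; apply: (measurableT_comp (measurable_powR p)).
  apply: measurableT_comp => //; apply: measurable_funB.
    exact: (measurable_fun_act (me_mpG c)) (measurable_transfer f).
  exact: measurable_transfer.
have H0 x : 0 <= H x by rewrite lee_fin powR_ge0.
rewrite -(unfoldG H)// (unfoldL H)//.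
(* The composite of [psi] and [me_cocycle] is not known to be measurable, as [xget] chooses
   arbitrarily on a null set. [Q] is a measurable function that agrees with it almost everywhere on
   [XL]. *)
pose Q x : \bar R :=
  \esum_(a in [set: Lambda]) ((psi a)%:E * (\1_XL (aL a (aG s x)))%:E).
have mQ : measurable_fun setT Q.
  apply: measurable_fun_esum => // [a x|a]; first by rewrite mule_ge0// lee_fin.
  apply: emeasurable_funM => //; apply/measurable_EFinP.
  have m1 : measurable_fun setT (fun y => \1_XL (aL a y) : R).
    by apply: (measurable_fun_act (me_mpL c)); exact: measurable_indic.
  exact: (measurable_fun_act (me_mpG c) _ _ _ s m1).
have Q0 x : 0 <= Q x.
  by apply: esum_ge0 => a _; rewrite mule_ge0// lee_fin.
have hits := ae_act countG (me_mpG c) _ hitL.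
have QE x : XL x -> (exists! l, XL (aL l (aG s x))) ->
    Q x = (psi (me_cocycle s x))%:E.
  move=> Xx [l [Xl ul]]; rewrite /Q.
  rewrite (esum_hit (fun a => (psi a)%:E) (me_cocycle s x))//.
  - by apply: me_cocycle_hit; exists l.
  - move=> k Xk; rewrite -(ul k)//; apply/esym/ul/me_cocycle_hit.
    by exists l.
apply: (@le_trans _ _ (\int[mu]_(x in XL) (t%:E * Q x))).
  apply: ae_ge0_le_integral => //.
  - by move=> x _; apply: esum_ge0.
  - apply: measurable_fun_esum => // l; apply: measurable_funTS.
    exact: (measurable_fun_act (me_mpL c)) mH.
  - by move=> x _; rewrite mule_ge0// lee_fin.
  - by apply: measurable_funTS; exact: emeasurable_funM.
  apply: filterS hits => x hx Xx.
  have [l [Xl ul]] := hx s; rewrite QE//.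
  have -> : me_cocycle s x = l.
    by apply/esym/ul/me_cocycle_hit; exists l.
  rewrite -EFinM; apply: le_trans (fpsi l).
  (* For [x] in [XL], the element moving [aL k^-1 x] into [XL] is [k]; after acting by [s] it is
     [l * k], with [l] the cocycle. Inverting the index thus yields the differences
     [f (l * k) - f k]. *)
  rewrite (reindex_esumT (fun k => k^-1)%g); last first.
    by exists (fun k => k^-1)%g => k; rewrite invgK.
  apply: le_esum => k _; rewrite /H me_commute.
  have [j [Xj uj]] := hx 1%g; rewrite (me_actionG c).1 in Xj uj.
  have j1 : j = 1%g.
    apply: uj; rewrite (me_actionL c).1 //.
  rewrite (@transfer_hit (l * k)%g).
  - rewrite (@transfer_hit k)//.
    + by rewrite actKV//; exact: me_actionL.
    + move=> h; rewrite -(me_actionL c).2 => /uj; rewrite j1 => /esym/eqP.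
      by rewrite mulg_eq1 invgK => /eqP.
  - by rewrite (me_actionL c).2 actKV//; exact: me_actionL.
  - move=> h; rewrite -(me_actionL c).2 => /ul ->.
    by rewrite mulgVK.
rewrite ge0_integralZl_EFin//; last exact: measurable_funTS.
rewrite lee_wpmul2l// ?lee_fin//.
apply: ae_le_lower_integral => //; first exact: measurable_funTS.
  by move=> x; rewrite lee_fin.
by apply: filterS hits => x hx Xx; rewrite QE//; exact: hx.
Qed.

End Transfer.

(** Each [g] in the support is a visit of some [aL l x] with [l] in the support of [f], so the sum
    of [visits (aL l x)] bounds their number. *)
Lemma transfer_supp (f : Lambda -> R) (M : nat) x :
  finite_set (supp f) -> ~ crowded M (fset_set (supp f)) x ->
  finite_set (supp (fun g => transfer f (aG g x))) /\
  (#|` fset_set (supp (fun g => transfer f (aG g x)))|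
     <= M * #|` fset_set (supp f)|)%N.
Proof.
move=> ff; rewrite /crowded /= => /negP; rewrite -leNgt => xM.
apply: (@esum_card_le R _
  (fun g => \sum_(l <- fset_set (supp f)) (\1_XL (aL l (aG g x)))%:E)).
- by move=> g; apply: sume_ge0 => l _; rewrite lee_fin.
- move=> g gx.
  have [l lf Xl] : exists2 l, l \in fset_set (supp f) & XL (aL l (aG g x)).
    apply: contrapT => H; move: gx; rewrite /supp /transfer /=.
    rewrite big_seq big1 ?eqxx// => l lf; rewrite indicE memNset ?mulr0// => Xl.
    by apply: H; exists l.
  rewrite (bigD1_seq l) ?fset_uniq//= indicE mem_set// leeDl//.
  by apply: sume_ge0 => k _; rewrite lee_fin.
- rewrite esum_sum; last by move=> g l _ _; rewrite lee_fin.
  apply: le_trans xM; apply: lee_sum => l _; apply: le_esum => g _.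
  by rewrite me_commute.
Qed.

(** Averaging over the uncrowded part of [XG] gives a point where gradient and norm compare well.
    The weights [t] and [psi] are left abstract to serve both forms of integrability. *)
Lemma transfer_function (S : {fset Gamma}) : exists2 M, (0 < M)%N &
  forall (p : R) (f : Lambda -> R) (t : Gamma -> R) (psi : Gamma -> Lambda -> R)
    (k : R), (1 <= p)%R -> finite_set (supp f) -> supp f !=set0 ->
  (forall s, 0 <= t s)%R -> (forall s a, 0 <= psi s a)%R ->
  (forall s a, s \in S ->
     \esum_(l in [set: Lambda]) (`|f (a * l)%g - f l| `^ p)%:E <=
     (t s * psi s a)%:E) ->
  (0 < k)%R ->
  \sum_(s <- S) ((t s)%:E * \int[mu]_(x in XL) (psi s (me_cocycle s x))%:E) <
    (k * (norm_sum p f * (m / 2)))%:E ->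
  exists h : Gamma -> R, [/\ finite_set (supp h), supp h !=set0,
    (#|` fset_set (supp h)| <= M * #|` fset_set (supp f)|)%N &
    (grad_sum p S h < k * norm_sum p h)%R].
Proof.
have [M M0 MP] := integral_visits_crowded; exists M => // p f t psi k p1 ff fn0.
move=> t0 psi0 fpsi k0 small.
have p0 : p != 0%R by rewrite gt_eqF// (lt_le_trans ltr01).
set A := fset_set (supp f) in MP *.
have A0 : (0 < size A)%N.
  have [l fl] := fn0; rewrite cardfs_gt0; apply/fset0Pn; exists l.
  by rewrite in_fset_set// inE.
set N := norm_sum p f.
pose P x := \esum_(g in [set: Gamma]) (`|transfer f (aG g x)| `^ p)%:E.
pose Qs s x := \esum_(g in [set: Gamma])
  (`|transfer f (aG s (aG g x)) - transfer f (aG g x)| `^ p)%:E.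
pose Q x := \sum_(s <- S) Qs s x.
have mtG g : measurable_fun setT (fun x => transfer f (aG g x)).
  exact: (measurable_fun_act (me_mpG c)) (measurable_transfer f).
have mP : measurable_fun setT P.
  apply: measurable_fun_esum => // g.
  apply/measurable_EFinP; apply: (measurableT_comp (measurable_powR p)).
  exact: measurableT_comp.
have mQs s : measurable_fun setT (Qs s).
  apply: measurable_fun_esum => // g.
  apply/measurable_EFinP; apply: (measurableT_comp (measurable_powR p)).
  apply: measurableT_comp => //; apply: measurable_funB => //.
  exact: (measurable_fun_act (me_mpG c) _ _ _ g (mtG s)).
have mQ : measurable_fun setT Q by exact: emeasurable_sum.
have P0 x : 0 <= P x by apply: esum_ge0 => g _; rewrite lee_fin powR_ge0.
have Qs0 s x : 0 <= Qs s x by apply: esum_ge0 => g _; rewrite lee_fin powR_ge0.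
have Q0 x : 0 <= Q x by exact: sume_ge0.
have mB : measurable (XG `&` crowded M A).
  by apply: measurableI => //; exact: measurable_crowded.
have mD : measurable (XG `\` crowded M A).
  by apply: measurableD => //; exact: measurable_crowded.
(* The total over [XG] is [N * m], and the crowded part carries at most half of it. *)
have intP : (N * (m / 2))%:E <= \int[mu]_(x in XG `\` crowded M A) P x.
  have : \int[mu]_(x in XG) P x = (N * m)%:E.
    rewrite integral_transfer_norm//.
    under eq_bigr do rewrite integral_visits measure_XLE -EFinM.
    by rewrite sumEFin -mulr_suml -norm_sum_fset.
  have : \int[mu]_(x in XG `&` crowded M A) P x <= (N * (m / 2))%:E.
    rewrite integral_transfer_norm// /N norm_sum_fset// mulr_suml -sumEFin.
    apply: lee_sum => l _; rewrite EFinM lee_wpmul2l ?lee_fin ?powR_ge0//.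
    exact: MP.
  rewrite -{2}(setUIDK XG (crowded M A)) ge0_integral_setU//; last 2 first.
  - by apply: measurable_funTS.
  - by apply/disj_setPS => x [[_ cx] [_ /(_ cx)]].
  move=> le1 eq1; rewrite -(leeD2lE (x := (N * (m / 2))%:E))// -EFinD.
  rewrite (_ : N * (m / 2) + N * (m / 2) = N * m)%R; last by lra.
  by rewrite -eq1 leeD2r.
have [x [XGx nx] QP] : exists2 x, (XG `\` crowded M A) x & Q x < k%:E * P x.
  apply: (@lt_integral_exists _ _ _ mu) => //.
  - by apply: measurable_funTS; exact: emeasurable_funM.
  - exact: measurable_funTS.
  - by move=> x; rewrite mule_ge0// lee_fin ltW.
  rewrite ge0_integralZl_EFin//; last 2 first.
  - exact: measurable_funTS.
  - exact: ltW.
  apply: (@lt_le_trans _ _ (k%:E * (N * (m / 2))%:E)); last first.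
    by rewrite lee_wpmul2l// lee_fin ltW.
  rewrite -EFinM; apply: le_lt_trans small.
  apply: (@le_trans _ _ (\int[mu]_(x in XG) Q x)).
    by apply: ge0_subset_integral => //; exact: measurable_funTS.
  rewrite ge0_integral_sum//; last by move=> s; exact: measurable_funTS.
  rewrite !big_seq; apply: lee_sum => s sS.
  by apply: integral_transfer_grad => // a; exact: fpsi.
pose h g := transfer f (aG g x).
have [fh ch] := transfer_supp _ _ _ ff nx.
have PE : P x = (norm_sum p h)%:E by rewrite norm_sumE.
have QE : Q x = (grad_sum p S h)%:E.
  rewrite grad_sumE//; apply: eq_bigr => s _; apply: eq_esum => g _.
  by rewrite /h (me_actionG c).2.
have gn : (grad_sum p S h < k * norm_sum p h)%R.
  by rewrite -lte_fin EFinM -PE -QE.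
exists h; split => //.
(* If [h] vanished, the strict inequality would make its gradient sum negative. *)
apply/set0P; apply: contraTneq gn => h0.
rewrite (_ : norm_sum p h = 0%R) ?mulr0 -?leNgt ?grad_sum_ge0//.
apply: fsbig1 => g _; suff -> : h g = 0%R by rewrite normr0 powR0.
apply: contrapT => /eqP hg; have : supp h g by [].
by rewrite h0.
Qed.

End Coupling.

(** * Translation by a group element against word length *)

Section WordBound.
Context {R : realType} {G : groupType}.
Implicit Types (p : R) (S : {fset G}) (f : G -> R).

(** Convexity of the [p]-th power at the points [|x|] and [|y| / n], with weights [1 / (n + 1)] and
    [n / (n + 1)]. These weights make the induction in [esum_word_le] close with the sharp factor
    [(size w)^p]. *)
Lemma powR_normD_le p (n : nat) (x y : R) : 1 <= p -> (0 < n)%N ->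
  `|x + y| `^ p <= n.+1%:R `^ p *
    (n.+1%:R^-1 * `|x| `^ p + (1 - n.+1%:R^-1) * (n%:R^-1 `^ p * `|y| `^ p)).
Proof.
move=> p1 n0; have p0 : 0 <= p by rewrite (le_trans ler01).
have N0 : (0 : R) < n.+1%:R by rewrite ltr0n.
have n0' : (n%:R : R) != 0 by rewrite pnatr_eq0 -lt0n.
set u : R := n.+1%:R^-1.
have u0 : 0 <= u by rewrite invr_ge0 ltW.
have u1 : u <= 1 by rewrite invf_le1// ler1n.
have uE : (1 - u) = n%:R * u.
  by apply: (mulIf (lt0r_neq0 N0)); rewrite mulrBl -mulrA mulVf ?gt_eqF// mulr1 mul1r -natr1 addrK.
rewrite -powRM ?invr_ge0 ?ler0n//.
set z := n%:R^-1 * `|y|.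
have z0 : 0 <= z by rewrite mulr_ge0 ?invr_ge0 ?ler0n.
apply: (@le_trans _ _ ((n.+1%:R * (u * `|x| + (1 - u) * z)) `^ p)).
  apply: ge0_ler_powR; rewrite ?nnegrE//.
    by rewrite mulr_ge0 ?addr_ge0 ?mulr_ge0 ?subr_ge0// ltW.
  rewrite mulrDr mulVKf ?gt_eqF// uE !mulrA (mulrAC _ n%:R) divff ?gt_eqF// mul1r.
  by rewrite divff// mul1r ler_normD.
rewrite powRM ?(ltW N0)//; last by rewrite addr_ge0 ?mulr_ge0 ?subr_ge0.
rewrite ler_pM2l ?powR_gt0//.
have := @convex_powR R p p1 (Itv01 u0 u1) `|x| z.
by rewrite !convRE /=; apply; rewrite inE /= in_itv /= andbT.
Qed.

Lemma esum_grad_le p S f s : p != 0 -> finite_set (supp f) -> s \in S ->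
  (\esum_(g in [set: G]) (`|f (s * g)%g - f g| `^ p)%:E <= (grad_sum p S f)%:E)%E.
Proof.
move=> p0 ff sS; rewrite grad_sumE// (bigD1_seq s) ?fset_uniq//= leeDl//.
by apply: sume_ge0 => t _; apply: esum_ge0 => g _; rewrite lee_fin powR_ge0.
Qed.

Lemma esum_word_le p S f (w : seq G) : countable [set: G] -> 1 <= p ->
  finite_set (supp f) -> {subset w <= S} ->
  (\esum_(g in [set: G]) (`|f ((\prod_(s <- w) s) * g)%g - f g| `^ p)%:E <=
   ((size w)%:R `^ p * grad_sum p S f)%:E)%E.
Proof.
move=> cG p1 ff; have p0 : p != 0 by rewrite gt_eqF// (lt_le_trans ltr01).
have V0 := grad_sum_ge0 p S f; set V := grad_sum p S f in V0 *.
elim: w => [|s w IH] wS.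
  rewrite esum1 ?lee_fin ?mulr_ge0 ?powR_ge0// => g _.
  by rewrite big_nil mul1g subrr normr0 powR0.
have sV : (\esum_(g in [set: G])
    (`|f (s * ((\prod_(t <- w) t) * g))%g - f ((\prod_(t <- w) t) * g)%g| `^ p)%:E
    <= V%:E)%E.
  rewrite -(@reindex_esumT _ _ _ (fun g => (\prod_(t <- w) t) * g)%g
    (fun g => (`|f (s * g)%g - f g| `^ p)%:E)); last first.
    by exists (fun g => (\prod_(t <- w) t)^-1 * g)%g => g; rewrite ?mulKg ?mulVKg.
  by apply: esum_grad_le => //; apply: wS; rewrite inE eqxx.
have {}IH := IH (fun t tw => wS t (mem_behead (tw : t \in behead (s :: w)))).
(* A one-letter word is treated apart, because the convexity bound divides by [n]. *)
have [w0|w0] := posnP (size w).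
  move: sV; rewrite (size0nil w0) big_seq1 /= powR1 mul1r; apply: le_trans.
  by apply: le_esum => g _; rewrite big_nil mul1g.
set n := size w in w0 IH *; rewrite /= -/n.
set x := fun g => f (s * ((\prod_(t <- w) t) * g))%g - f ((\prod_(t <- w) t) * g)%g.
set y := fun g => f ((\prod_(t <- w) t) * g)%g - f g.
pose N : R := n.+1%:R `^ p.
pose u : R := n.+1%:R^-1.
have u0 : 0 <= u by rewrite invr_ge0 ler0n.
have u1 : 0 <= 1 - u by rewrite subr_ge0 invf_le1 ?ltr0n// ler1n.
have N0 : 0 <= N by exact: powR_ge0.
have i0 : 0 <= n%:R^-1 `^ p :> R by exact: powR_ge0.
apply: (@le_trans _ _ (\esum_(g in [set: G])
    ((N * u)%:E * (`|x g| `^ p)%:E +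
     (N * ((1 - u) * n%:R^-1 `^ p))%:E * (`|y g| `^ p)%:E))%E).
  apply: le_esum => g _; rewrite -!EFinM -EFinD lee_fin.
  have -> : f ((\prod_(t <- s :: w) t) * g)%g - f g = x g + y g.
    by rewrite /x /y big_cons mulgA subrKA.
  apply: le_trans (powR_normD_le p n _ _ p1 w0) _.
  by rewrite mulrDr -/N -/u !mulrA.
have a0 (h : G -> R) g : (0 <= (`|h g| `^ p)%:E :> \bar R)%E.
  by rewrite lee_fin powR_ge0.
rewrite esumD; last 2 first.
- by move=> g _; rewrite mule_ge0// lee_fin mulr_ge0.
- by move=> g _; rewrite mule_ge0// lee_fin !mulr_ge0.
rewrite !ge0_esumZl//; try by rewrite !mulr_ge0.
apply: (@le_trans _ _ ((N * u)%:E * V%:E +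
    (N * ((1 - u) * n%:R^-1 `^ p))%:E * (n%:R `^ p * V)%:E)%E).
  by apply: leeD; rewrite lee_wpmul2l// lee_fin !mulr_ge0.
(* The powers of [n] cancel and the weights [u] and [1 - u] add up to 1, leaving exactly [N * V]. *)
rewrite -!EFinM -EFinD lee_fin le_eqVlt; apply/orP; left; apply/eqP.
have nn : n%:R^-1 `^ p * n%:R `^ p = 1 :> R.
  by rewrite -powRM ?invr_ge0 ?ler0n// mulVf ?powR1// pnatr_eq0 -lt0n.
rewrite -/N [X in _ + X](_ : _ = N * (1 - u) * (n%:R^-1 `^ p * n%:R `^ p) * V); last first.
  by rewrite !mulrA.
by rewrite nn mulr1 -mulrDl -mulrDr addrC subrK mulr1.
Qed.

Lemma word_length_attained S (a : G) : (forall g, words S g !=set0) ->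
  exists2 w : seq G, words S a w & (size w)%:R = word_length R S a.
Proof.
move=> gen; have [w0 w0a] := gen a.
have ex : exists n, `[< exists2 w : seq G, words S a w & size w = n >].
  by exists (size w0); apply/asboolP; exists w0.
have [n /asboolP[w wa wn] nmin] := ex_minnP ex.
exists w => //; apply/eqP; rewrite eq_le; apply/andP; split.
  apply: lb_le_inf; first by exists (size w0)%:R; exists w0.
  move=> _ [v va <-]; rewrite ler_nat wn; apply: nmin.
  by apply/asboolP; exists v.
apply: ge_inf; last by exists w.
by exists 0 => _ [v _ <-].
Qed.

Lemma word_length_ge0 S (a : G) : (forall g, words S g !=set0) ->
  0 <= word_length R S a.
Proof. by move=> /word_length_attained -/(_ a)[w _ <-]. Qed.

Lemma esum_translate_le p S f (a : G) : symmetric_generating S -> 1 <= p ->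
  finite_set (supp f) ->
  (\esum_(g in [set: G]) (`|f (a * g)%g - f g| `^ p)%:E <=
   (word_length R S a `^ p * grad_sum p S f)%:E)%E.
Proof.
move=> Sgen p1 ff; have [w [wS <-] <-] := word_length_attained S a Sgen.2.
by apply: esum_word_le => //; exact: symmetric_generating_countable Sgen.
Qed.

(** Triangle inequality and translation invariance. This replaces [esum_translate_le] when [a] is
    long. *)
Lemma esum_translate_le2 f (a : G) : finite_set (supp f) ->
  (\esum_(g in [set: G]) (`|f (a * g)%g - f g| `^ 1)%:E <=
   (2 * norm_sum 1 f)%:E)%E.
Proof.
move=> ff; have o0 : 1 != 0 :> R by exact: oner_neq0.
have N0 h g : (0 <= (`|h g| `^ 1)%:E :> \bar R)%E by rewrite lee_fin powR_ge0.
apply: (@le_trans _ _ (\esum_(g in [set: G])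
    ((`|f (a * g)%g| `^ 1)%:E + (`|f g| `^ 1)%:E))%E).
  by apply: le_esum => g _; rewrite -EFinD lee_fin !powRr1// ler_normB.
rewrite esumD//.
rewrite -(@reindex_esumT _ _ _ (fun g => a * g)%g (fun g => (`|f g| `^ 1)%:E)).
  by rewrite -norm_sumE// -EFinD lee_fin mulr_natl mulr2n.
by exists (fun g => a^-1 * g)%g => g; rewrite ?mulKg ?mulVKg.
Qed.

End WordBound.

(** * The profile in terms of norm and gradient sums *)

Section Profile.
Context {R : realType} {G : groupType}.
Implicit Types (p r : R) (S : {fset G}) (f : G -> R).

(** Raise to the power [p]. With zero gradient both sides hold, which matches the value [+oo] of the
    ratio. *)
Lemma le_profile_ratioP p S f r : 1 <= p -> 0 <= r ->
  ((r%:E <= profile_ratio p S f)%E <-> r `^ p * grad_sum p S f <= norm_sum p f).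
Proof.
move=> p1 r0; have p0 : 0 < p by rewrite (lt_le_trans ltr01).
have pV0 : p^-1 != 0 by rewrite invr_eq0 gt_eqF.
have N0 := norm_sum_ge0 p f; have V0 := grad_sum_ge0 p S f.
rewrite /profile_ratio (_ : lp_grad p S f = grad_sum p S f `^ p^-1)//.
rewrite (_ : lp_norm p f = norm_sum p f `^ p^-1)//.
have rootK x : 0 <= x -> (x `^ p^-1) `^ p = x.
  by move=> x0; rewrite -powRrM mulVf ?gt_eqF// powRr1.
rewrite powR_eq0 pV0 andbT; case: ifPn => [/eqP ->|V1].
  by rewrite mulr0 leey; split.
have Vp : 0 < grad_sum p S f `^ p^-1 by rewrite powR_gt0// lt0r V1.
rewrite lee_fin ler_pdivlMr//; split=> h.
  rewrite -[leRHS]rootK// -[X in _ * X <= _]rootK// -powRM ?powR_ge0//.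
  by apply: ge0_ler_powR; rewrite ?nnegrE ?mulr_ge0 ?powR_ge0// ltW.
have : (r `^ p * grad_sum p S f) `^ p^-1 <= norm_sum p f `^ p^-1.
  by apply: ge0_ler_powR; rewrite ?nnegrE ?mulr_ge0 ?powR_ge0 ?invr_ge0// ltW.
by rewrite powRM ?powR_ge0// -powRrM mulfV ?gt_eqF// powRr1.
Qed.

Lemma le_profile p S f n r : 1 <= p -> 0 <= r -> finite_set (supp f) ->
  supp f !=set0 -> (#|` fset_set (supp f)| <= n)%N ->
  r `^ p * grad_sum p S f <= norm_sum p f ->
  (r%:E <= isoperimetric_profile p S n)%E.
Proof.
move=> p1 r0 ff fn fc /(le_profile_ratioP p S f r p1 r0).2/le_trans; apply.
by apply: ereal_sup_ubound; exists f.
Qed.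

Lemma lt_profile p S n r : 1 <= p -> 0 <= r ->
  (r%:E < isoperimetric_profile p S n)%E ->
  exists f, [/\ finite_set (supp f), supp f !=set0,
    (#|` fset_set (supp f)| <= n)%N &
    r `^ p * grad_sum p S f <= norm_sum p f].
Proof.
move=> p1 r0 /ereal_sup_gt[_ [f [ff fn fc] <-] /ltW rf].
by exists f; split => //; exact/le_profile_ratioP.
Qed.

(** The indicator of the identity is admissible as soon as [n >= 1]; for [n = 0] the supremum is
    over the empty set. *)
Lemma profile_ge0 p S n : 1 <= p -> (0 < n)%N ->
  (0 <= isoperimetric_profile p S n)%E.
Proof.
move=> p1 n0; pose f (g : G) : R := (g == 1%g)%:R.
have sf : supp f = [set 1%g].
  by apply/seteqP; split=> g; rewrite /supp /f /= pnatr_eq0 eqb0 negbK => /eqP.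
apply: (le_profile p S f) => //.
- by rewrite sf.
- by rewrite sf; exists 1%g.
- by rewrite sf fset_set1 cardfs1.
by rewrite powR0 ?mul0r ?norm_sum_ge0// gt_eqF// (lt_le_trans ltr01).
Qed.

End Profile.

Lemma le_from_pos_reals {R : realType} (x y : \bar R) : (0 <= y)%E ->
  (forall r : R, 0 < r -> (r%:E < x)%E -> (r%:E <= y)%E) -> (x <= y)%E.
Proof.
move=> y0 H; rewrite leNgt; apply/negP => yx.
case: y y0 H yx => [y| |]//; last by move=> _ _; rewrite ltNge leey.
rewrite lee_fin => y0 H yx; have [r yr rx] : exists2 r : R, y < r & (r%:E < x)%E.
  case: x yx {H} => [x| |]// yx; last first.
    by exists (y + 1); [rewrite ltrDl|rewrite ltry].
  by rewrite lte_fin in yx; exists ((y + x) / 2); rewrite ?lte_fin; lra.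
have := H r (le_lt_trans y0 yr) rx.
by rewrite lee_fin leNgt yr.
Qed.

(** * Comparison of the profiles *)

Section Conclusion.
Context {R : realType} {Gamma Lambda : groupType}.
Variables (c : me_coupling R Gamma Lambda).
Variables (SG : {fset Gamma}) (SL : {fset Lambda}).
Hypothesis SG_gen : symmetric_generating SG.
Hypothesis SL_gen : symmetric_generating SL.
Variable phi : R -> R.
Hypothesis phi_gt0 : forall t, 0 < t -> 0 < phi t.
Hypothesis phi_int : phi_L0_integrable c SL phi.

Lemma extend0_ge0 t : 0 <= extend0 phi t.
Proof. by rewrite /extend0; case: ifPn => // /phi_gt0/ltW. Qed.

(** The common core of both comparisons. [J] is a level below the profile of [Lambda], and [kappa]
    absorbs the rescaling constants [cg s]. Integrating the assumed bound along the cocycle gives a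
    gradient of order [norm_sum p f / phi J]. *)
Lemma profile_transfer (p : R) (kappa : R -> R) : 1 <= p ->
  (forall x, 0 < x -> 0 <= kappa x) ->
  exists2 M, (0 < M)%N & exists2 C : R, 0 < C & exists2 cg : Gamma -> R,
    (forall s, 0 < cg s) &
  forall (f : Lambda -> R) (J : R) n, 0 < J -> finite_set (supp f) ->
    supp f !=set0 -> (#|` fset_set (supp f)| <= n)%N ->
    (forall s a, (\esum_(l in [set: Lambda]) (`|f (a * l)%g - f l| `^ p)%:E <=
      (norm_sum p f / phi J * kappa (cg s) *
       extend0 phi (word_length R SL a / cg s))%:E)%E) ->
    forall r, 0 <= r -> C * r `^ p <= phi J ->
    (r%:E <= isoperimetric_profile p SG (M * n))%E.
Proof.
move=> p1 kappa0; have p0 : p != 0 by rewrite gt_eqF// (lt_le_trans ltr01).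
have /choice[cg cgP] : forall s, exists cg : R, 0 < cg /\
    (\int[me_mu c]_(x in me_XL c)
       (extend0 phi (word_length R SL (me_cocycle s x) / cg))%:E < +oo)%E.
  by move=> s; have [r r0 rP] := phi_int s; exists r.
have cG := symmetric_generating_countable _ SG_gen.
have cL := symmetric_generating_countable _ SL_gen.
have [M M0 MP] := transfer_function c cG cL SG.
have m0 := measure_XL_gt0 c cL.
set m := fine _ in MP m0.
pose I s : R := fine (\int[me_mu c]_(x in me_XL c)
       (extend0 phi (word_length R SL (me_cocycle s x) / cg s))%:E)%E.
have I0 s : 0 <= I s.
  by apply/fine_ge0/integral_ge0 => x _; rewrite lee_fin extend0_ge0.
have IE s : (\int[me_mu c]_(x in me_XL c)
    (extend0 phi (word_length R SL (me_cocycle s x) / cg s))%:E = (I s)%:E)%E.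
  rewrite /I fineK// ge0_fin_numE ?(cgP s).2//.
  by apply: integral_ge0 => x _; rewrite lee_fin extend0_ge0.
(* The added 1 makes [L] positive and the inequality [small] strict. The constant [2 * L / m] below
   cancels the factor [m / 2] of [transfer_function]. *)
pose L := \sum_(s <- SG) kappa (cg s) * I s + 1.
have L0 : 0 < L.
  rewrite ltr_wpDl// sumr_ge0// => s _.
  by rewrite mulr_ge0// kappa0// (cgP s).1.
have C0 : 0 < 2 * L / m by rewrite divr_gt0// mulr_gt0.
exists M => //; exists (2 * L / m) => //; exists cg; first by move=> s; exact: (cgP s).1.
move=> f J n J0 ff fn fc fW r r0 Cr.
have phiJ := phi_gt0 J J0.
have N0 := norm_sum_gt0 p f p0 ff fn; set N := norm_sum p f in N0 fW.
have k0 : 0 < 2 * L / m / phi J by rewrite divr_gt0.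
pose t s := N / phi J * kappa (cg s).
have t0 s : 0 <= t s.
  by rewrite mulr_ge0// ?kappa0 ?(cgP s).1// divr_ge0// ltW.
have small : (\sum_(s <- SG) ((t s)%:E * \int[me_mu c]_(x in me_XL c)
    (extend0 phi (word_length R SL (me_cocycle s x) / cg s))%:E) <
    (2 * L / m / phi J * (N * (m / 2)))%:E)%E.
  under eq_bigr do rewrite IE -EFinM.
  rewrite sumEFin lte_fin.
  under eq_bigr do rewrite -mulrA.
  rewrite -mulr_sumr.
  have -> : 2 * L / m / phi J * (N * (m / 2)) = N / phi J * L.
    rewrite (_ : _ * _ = N / phi J * L * (m / m) * (2 / 2)).
      by rewrite !divff ?gt_eqF// !mulr1.
    lra.
  by rewrite ltr_pM2l ?divr_gt0// /L ltrDl.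
have [h [fh hn hc hg]] := MP p f t
  (fun s a => extend0 phi (word_length R SL a / cg s)) (2 * L / m / phi J)
  p1 ff fn t0 (fun s a => extend0_ge0 _) (fun s a _ => fW s a) k0 small.
apply: (le_profile p SG h) => //.
  by apply: leq_trans hc _; rewrite leq_mul2l fc orbT.
apply: (@le_trans _ _ (phi J / (2 * L / m) * grad_sum p SG h)).
  by rewrite ler_wpM2r ?grad_sum_ge0// ler_pdivlMr// mulrC.
rewrite [X in X * _](_ : _ = (2 * L / m / phi J)^-1); last by rewrite [RHS]invf_div.
by rewrite mulrC ler_pdivrMr// mulrC ltW.
Qed.

Lemma truncn_mul_nat (M n : nat) : Num.truncn (M%:R * n%:R : R) = (M * n)%N.
Proof. by rewrite -natrM natrK. Qed.

Lemma asymp_le_profile_power (p : R) : 1 <= p ->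
  (forall t, 0 < t -> phi t = t `^ p) ->
  asymp_le (isoperimetric_profile p SL) (isoperimetric_profile p SG).
Proof.
move=> p1 phiE; have p0 : p != 0 by rewrite gt_eqF// (lt_le_trans ltr01).
have [//|M M0 [C C0 [cg cg0 H]]] := profile_transfer p (fun x => x `^ p) p1 _.
  by move=> x _; exact: powR_ge0.
exists M%:R; first by rewrite ltr0n.
(* Chosen so that [C * (r / K)^p = r^p = phi r]. *)
pose K := C `^ p^-1; have K0 : 0 < K by rewrite powR_gt0.
have KC : K `^ p = C by rewrite -powRrM mulVf// powRr1// ltW.
exists K => //; near=> n; have n0 : (0 < n)%N by near: n; exact: nbhs_infty_gt.
rewrite truncn_mul_nat; apply: le_from_pos_reals => [|r r0].
  by rewrite mule_ge0 ?lee_fin ?profile_ge0 ?muln_gt0 ?M0// ltW.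
move=> /(lt_profile p SL n r p1 (ltW r0))[f [ff fn fc fr]].
have -> : r = K * (r / K) by rewrite mulrC divfK ?gt_eqF.
rewrite EFinM lee_wpmul2l ?lee_fin ?(ltW K0)//.
apply: (H f r) => //; last 2 first.
- by rewrite divr_ge0// ltW.
- by rewrite -KC -powRM ?divr_ge0 ?(ltW K0) ?(ltW r0)// mulrC divfK ?gt_eqF// phiE.
move=> s a; apply: le_trans (esum_translate_le p SL f a SL_gen p1 ff) _.
rewrite lee_fin phiE//; have w0 := word_length_ge0 (R := R) SL a SL_gen.2.
rewrite /extend0; case: ifPn => [wc|].
  rewrite phiE// -mulrA -powRM ?(ltW wc) ?(ltW (cg0 s))// (mulrC (cg s)) divfK ?gt_eqF//.
  rewrite [leRHS]mulrC ler_pM2l ?powR_gt0//; last first.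
    by move: wc; rewrite pmulr_lgt0 ?invr_gt0.
  by rewrite ler_pdivlMr ?powR_gt0// mulrC.
rewrite pmulr_lgt0 ?invr_gt0// -leNgt => w0'.
have -> : word_length R SL a = 0 by apply/eqP; rewrite eq_le w0 w0'.
by rewrite powR0// mul0r mulr0.
Unshelve. all: by end_near. Qed.

Hypothesis phi_nondecr : nondecreasing_pos phi.
Hypothesis t_phi_nondecr : nondecreasing_pos (fun t => t / phi t).

(** Take [f] of ratio at least [J] and put [x = |a| / cg s]. If [x <= J], monotonicity of
    [t / phi t] gives [x <= J / phi J * phi x], and the word-length bound suffices. If [x > J], then
    [phi x >= phi J], and the trivial bound by twice the norm suffices. Hence [kappa] is the maximum
    of 2 and [cg s]. *)
Lemma asymp_le_profile_phi :
  asymp_le (extend_oo phi \o isoperimetric_profile 1 SL)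
           (isoperimetric_profile 1 SG).
Proof.
have [//|M M0 [C C0 [cg cg0 H]]] := profile_transfer 1 (fun x => Num.max 2 x) (lexx 1) _.
  by move=> x _; rewrite le_max ler0n.
exists M%:R; first by rewrite ltr0n.
(* The extra 2 arises because [key] reaches only levels strictly below the profile: at a finite
   value [r] it is applied to [r / 2]. *)
exists (2 * C); first by rewrite mulr_gt0.
near=> n; have n0 : (0 < n)%N by near: n; exact: nbhs_infty_gt.
rewrite truncn_mul_nat /=.
have P0 : (0 <= isoperimetric_profile (1 : R) SG (M * n))%E.
  by apply: profile_ge0 => //; rewrite muln_gt0 M0.
have key J : 0 < J -> (J%:E < isoperimetric_profile 1 SL n)%E ->
    ((phi J)%:E <= C%:E * isoperimetric_profile 1 SG (M * n))%E.
  move=> J0 /(lt_profile 1 SL n J (lexx 1) (ltW J0))[f [ff fn fc]].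
  rewrite powRr1 ?(ltW J0)// => fJ.
  have phiJ := phi_gt0 J J0; have N0 := norm_sum_ge0 1 f.
  have -> : phi J = C * (phi J / C) by rewrite mulrC divfK ?gt_eqF.
  rewrite EFinM lee_wpmul2l ?lee_fin ?(ltW C0)//.
  apply: (H f J) => //; last 2 first.
  - by rewrite divr_ge0// ltW.
  - by rewrite powRr1 ?divr_ge0 ?(ltW C0) ?(ltW phiJ)// mulrC divfK ?gt_eqF.
  move=> s a; set u := word_length R SL a; have c0 := cg0 s.
  have w0 : 0 <= u := word_length_ge0 (R := R) SL a SL_gen.2.
  have Wu : (\esum_(l in [set: Lambda]) (`|f (a * l)%g - f l| `^ 1)%:E <=
      (u * grad_sum 1 SL f)%:E)%E.
    by have := esum_translate_le 1 SL f a SL_gen (lexx 1) ff; rewrite powRr1.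
  rewrite /extend0; case: ifPn => [x0|]; last first.
    rewrite pmulr_lgt0 ?invr_gt0// -leNgt => w0'.
    have u0 : u = 0 by apply/eqP; rewrite eq_le w0 w0'.
    by rewrite mulr0; move: Wu; rewrite u0 mul0r.
  set x := u / cg s in x0 *.
  have phix := phi_gt0 x x0.
  have [xJ|Jx] := leP x J.
    apply: le_trans Wu _; rewrite lee_fin.
    have := t_phi_nondecr x J x0 xJ; rewrite ler_pdivrMr// => xphi.
    have -> : u = x * cg s by rewrite /x divfK ?gt_eqF.
    apply: (@le_trans _ _ (J / phi J * phi x * cg s * grad_sum 1 SL f)).
      by rewrite ler_wpM2r ?grad_sum_ge0// ler_pM2r.
    have -> : J / phi J * phi x * cg s * grad_sum 1 SL f =
        (phi x / phi J * cg s) * (J * grad_sum 1 SL f) by lra.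
    have -> : norm_sum 1 f / phi J * Num.max 2 (cg s) * phi x =
        (phi x / phi J * Num.max 2 (cg s)) * norm_sum 1 f by lra.
    apply: ler_pM => //.
    - by rewrite mulr_ge0 ?divr_ge0// ltW.
    - by rewrite mulr_ge0 ?grad_sum_ge0// ltW.
    - by rewrite ler_pM2l ?divr_gt0// le_max lexx orbT.
  apply: le_trans (esum_translate_le2 f a ff) _; rewrite lee_fin.
  have phiJx : phi J <= phi x by apply: phi_nondecr => //; exact: ltW.
  have -> : norm_sum 1 f / phi J * Num.max 2 (cg s) * phi x =
      (Num.max 2 (cg s) * (phi x / phi J)) * norm_sum 1 f by lra.
  rewrite ler_wpM2r// -[leLHS]mulr1; apply: ler_pM => //.
    by rewrite le_max lexx.
  by rewrite ler_pdivlMr// mul1r.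
have CP0 : (0 <= C%:E * isoperimetric_profile 1 SG (M * n))%E.
  by rewrite mule_ge0// lee_fin ltW.
have C2E : ((2 * C)%:E * isoperimetric_profile 1 SG (M * n) =
    2%:E * (C%:E * isoperimetric_profile 1 SG (M * n)))%E by rewrite EFinM muleA.
have C2P0 : (0 <= 2%:E * (C%:E * isoperimetric_profile 1 SG (M * n)))%E.
  by rewrite mule_ge0// lee_fin.
rewrite C2E.
case: (isoperimetric_profile 1 SL n) key => [r| |] key //=.
- rewrite /extend0; case: ifPn => // r0.
  (* [t / phi t] nondecreasing gives [phi r <= 2 phi (r / 2)] *)
  have h0 : 0 < r / 2 by rewrite divr_gt0.
  have hr : r / 2 < r by rewrite ltr_pdivrMr// ltr_pMr// ltr1n.
  have := t_phi_nondecr (r / 2) r h0 (ltW hr).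
  rewrite ler_pdivlMr ?phi_gt0// mulrAC ler_pdivrMr ?phi_gt0//.
  have -> : r / 2 * phi r = r * (phi r / 2) by lra.
  rewrite ler_pM2l// ler_pdivrMr// => phir.
  apply: (@le_trans _ _ (2%:E * (phi (r / 2))%:E)%E).
    by rewrite -EFinM lee_fin mulrC.
  by rewrite lee_wpmul2l ?lee_fin// key.
(* At [+oo] the value is the supremum of [phi], and every positive [s] is an admissible level. *)
- apply: ge_ereal_sup => _ [s s0 <-].
  apply: (@le_trans _ _ (C%:E * isoperimetric_profile 1 SG (M * n))%E).
    by apply: key => //; exact: ltry.
  by rewrite -[leLHS]mul1e lee_wpmul2r// lee_fin ler1n.
Unshelve. all: by end_near. Qed.

End Conclusion.

Theorem theorem1 (R : realType) (Gamma Lambda : groupType)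
  (SG : {fset Gamma}) (SL : {fset Lambda})
  (SG_gen : symmetric_generating SG) (SL_gen : symmetric_generating SL)
  (phi : R -> R)
  (phi_gt0 : forall t, 0 < t -> 0 < phi t)
  (phi_nondecr : nondecreasing_pos phi)
  (coupling : exists c : me_coupling R Gamma Lambda, phi_L0_integrable c SL phi) :
  (forall p : R, 1 <= p -> (forall t, 0 < t -> phi t = t `^ p) ->
     asymp_le (isoperimetric_profile p SL) (isoperimetric_profile p SG)) /\
  (nondecreasing_pos phi -> nondecreasing_pos (fun t => t / phi t) ->
     asymp_le (extend_oo phi \o isoperimetric_profile 1 SL)
              (isoperimetric_profile 1 SG)).
Proof.
have [c phi_int] := coupling; split=> [p p1 phiE|_ t_phi].
  exact: (asymp_le_profile_power c SG SL SG_gen SL_gen phi phi_gt0 phi_int).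
exact: (asymp_le_profile_phi c SG SL SG_gen SL_gen phi phi_gt0 phi_int).
Qed.
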